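(* Let $\mathcal C$ be a pre-rigid braided monoidal category such that the finite dual functor $(-)^\circ\colon \mathsf{Mon}(\mathcal C)\to\mathsf{Comon}(\mathcal C)$ exists, and $\alpha_M\otimes \mathrm{id}_N$ and $\theta_{M,N}$ are monomorphisms for all objects $M,N$. Let $A$ and $B$ be $\Omega$-magmas in $\mathcal C$, let $U$ be an object, and let $\rho_U\colon A\to B\otimes U$ be a tensor epimorphism such that the $U$-universal comeasuring monoid $\mathcal A^\square(\rho_U)$ (with universal comeasuring $\rho_U^{\mathbf{Comeas}}$) and the $U^*$-universal measuring comonoid ${}_\square\mathcal C(\rho_U^\vee)$ (with universal measuring $(\rho_U^\vee)^{\mathbf{Meas}}$) exist. Then $$\left(\rho_U^{\mathbf{Comeas}}\right)^\vee(\varkappa_{\mathcal A^\square(\rho_U)}\otimes \mathrm{id}_A)\colon \mathcal A^\square(\rho_U)^\circ\otimes A\to B$$ is a measuring, and the unique comonoid homomorphism $\beta\colon \mathcal A^\square(\rho_U)^\circ\to{}_\square\mathcal C(\rho_U^\vee)$ such that $$(\rho_U^\vee)^{\mathbf{Meas}}(\beta\otimes \mathrm{id}_A)=\left(\rho_U^{\mathbf{Comeas}}\right)^\vee(\varkappa_{\mathcal A^\square(\rho_U)}\otimes \mathrm{id}_A)$$ is a comonoid isomorphism.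
   Context: Associativity and unit constraints are suppressed; $c$ is the braiding and $\mathbf 1$ the monoidal unit of $\mathcal C$; $\mathsf{Mon}(\mathcal C)$, $\mathsf{Comon}(\mathcal C)$ are the categories of monoids and comonoids in $\mathcal C$. $\Omega$-magmas. $\Omega$ is a fixed set with maps $s,t\colon\Omega\to\mathbb Z_{\geq 0}$. An $\Omega$-magma in $\mathcal C$ is an object $A$ with morphisms $\omega_A\colon A^{\otimes s(\omega)}\to A^{\otimes t(\omega)}$ for all $\omega\in\Omega$ ($A^{\otimes 0}=\mathbf 1$; no identities are required). Measurings. For a comonoid $(P,\Delta,\varepsilon)$ and $\psi_i\colon P\otimes A_i\to B_i$, put $\psi_1\tilde\otimes\psi_2=(\psi_1\otimes\psi_2)(\mathrm{id}_P\otimes c_{P,A_1}\otimes \mathrm{id}_{A_2})(\Delta\otimes \mathrm{id}_{A_1\otimes A_2})$; $\psi^{\tilde\otimes n}$ is the iterated product, $\psi^{\tilde\otimes 0}$ is $P\otimes\mathbf 1\cong P\xrightarrow{\varepsilon}\mathbf 1$. A measuring from $A$ to $B$ is a morphism $\psi\colon P\otimes A\to B$, $P$ a comonoid, with $\omega_B\,\psi^{\tilde\otimes s(\omega)}=\psi^{\tilde\otimes t(\omega)}(\mathrm{id}_P\otimes\omega_A)$ for all $\omega\in\Omega$. Comeasurings. For a monoid $(Q,\mu,u)$ and $\rho_i\colon A_i\to B_i\otimes Q$, put $\rho_1\tilde\otimes\rho_2=(\mathrm{id}_{B_1\otimes B_2}\otimes\mu)(\mathrm{id}_{B_1}\otimes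 c_{Q,B_2}\otimes \mathrm{id}_Q)(\rho_1\otimes\rho_2)$; $\rho^{\tilde\otimes 0}$ is $\mathbf 1\xrightarrow{u}Q\cong\mathbf 1\otimes Q$. A comeasuring from $A$ to $B$ is a morphism $\rho\colon A\to B\otimes Q$, $Q$ a monoid, with $\rho^{\tilde\otimes t(\omega)}\omega_A=(\omega_B\otimes \mathrm{id}_Q)\rho^{\tilde\otimes s(\omega)}$ for all $\omega\in\Omega$. Tensor epi/monomorphisms. $\rho\colon A\to B\otimes Q$ is a tensor epimorphism if $(\mathrm{id}_B\otimes f)\rho=(\mathrm{id}_B\otimes g)\rho$ implies $f=g$ for all $f,g\colon Q\to R$. $\psi\colon P\otimes A\to B$ is a tensor monomorphism if $\psi(f\otimes \mathrm{id}_A)=\psi(g\otimes \mathrm{id}_A)$ implies $f=g$ for all $f,g\colon R\to P$. Universal objects. For a tensor epimorphism $\rho_U\colon A\to B\otimes U$, consider all comeasurings $\rho\colon A\to B\otimes Q$ ($Q$ any monoid) for which there is a morphism $\tau\colon U\to Q$ in $\mathcal C$ with $(\mathrm{id}_B\otimes\tau)\rho_U=\rho$; a morphism from $\rho_1$ to $\rho_2$ is a monoid homomorphism $\varphi\colon Q_1\to Q_2$ with $(\mathrm{id}_B\otimes\varphi)\rho_1=\rho_2$. The initial object of this category, if it exists, is $\rho_U^{\mathbf{Comeas}}\colon A\to B\otimes\mathcal A^\square(\rho_U)$. For a tensor monomorphism $\psi_V\colon V\otimes A\to B$, consider all measurings $\psi\colon P\otimes A\to B$ ($P$ any comonoid)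 for which there is $\tau\colon P\to V$ in $\mathcal C$ with $\psi_V(\tau\otimes \mathrm{id}_A)=\psi$; a morphism $\psi_1\to\psi_2$ is a comonoid homomorphism $\varphi\colon P_1\to P_2$ with $\psi_2(\varphi\otimes \mathrm{id}_A)=\psi_1$. The terminal object of this category, if it exists, is $\psi_V^{\mathbf{Meas}}\colon{}_\square\mathcal C(\psi_V)\otimes A\to B$. (Under the hypotheses of the claim $\rho_U^\vee$ is a tensor monomorphism, so ${}_\square\mathcal C(\rho_U^\vee)$ makes sense.) Pre-rigidity. $\mathcal C$ is pre-rigid if for every object $A$ there are a fixed object $A^*$ and morphism $\mathrm{ev}_A\colon A^*\otimes A\to\mathbf 1$ such that $f\mapsto \mathrm{ev}_A(f\otimes \mathrm{id}_A)$ is a bijection $\mathcal C(B,A^* )\to\mathcal C(B\otimes A,\mathbf 1)$ for every $B$. For $f\colon A\to B$, $f^*\colon B^*\to A^*$ is defined by $\mathrm{ev}_A(f^*\otimes \mathrm{id}_A)=\mathrm{ev}_B(\mathrm{id}_{B^*}\otimes f)$. The morphism $\theta_{A,B}\colon A^*\otimes B^*\to(A\otimes B)^*$ is defined by $\mathrm{ev}_{A\otimes B}(\theta_{A,B}\otimes \mathrm{id}_{A\otimes B})=(\mathrm{ev}_A\otimes \mathrm{ev}_B)(\mathrm{id}_{A^*}\otimes c^{-1}_{A,B^*}\otimes \mathrm{id}_B)$; $\iota\colon\mathbf 1\to\mathbf 1^*$ by: $\mathrm{ev}_{\mathbf 1}(\iota\otimes \mathrm{id}_{\mathbf 1})$ is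 the canonical isomorphism $\mathbf 1\otimes\mathbf 1\cong\mathbf 1$; $\alpha_A\colon A\to A^{**}$ by $\mathrm{ev}_{A^*}(\alpha_A\otimes \mathrm{id}_{A^*})c_{A^*,A}=\mathrm{ev}_A$. For a comonoid $(C,\Delta,\varepsilon)$, $C^*$ is a monoid with multiplication $\Delta^*\theta_{C,C}$ and unit $\varepsilon^*\iota$; this gives a contravariant functor $(-)^*\colon\mathsf{Comon}(\mathcal C)\to\mathsf{Mon}(\mathcal C)$. For $\rho\colon A\to B\otimes Q$, $\rho^\vee\colon Q^*\otimes A\to B$ is $(\mathrm{id}_B\otimes \mathrm{ev}_Q)(c_{Q^*,B}\otimes \mathrm{id}_Q)(\mathrm{id}_{Q^*}\otimes\rho)$. Finite dual. $(-)^\circ$ is a contravariant functor $\mathsf{Mon}(\mathcal C)\to\mathsf{Comon}(\mathcal C)$ with a natural bijection $\mathsf{Mon}(\mathcal C)(A,C^* )\cong\mathsf{Comon}(\mathcal C)(C,A^\circ)$. If $\eta_A\colon A\to A^{\circ*}$ corresponds to $\mathrm{id}_{A^\circ}$, then $\varkappa_A\colon A^\circ\to A^*$ is the morphism of $\mathcal C$ defined by $\mathrm{ev}_A(\varkappa_A\otimes \mathrm{id}_A)=\mathrm{ev}_{A^\circ}(\eta_A\otimes \mathrm{id}_{A^\circ})c_{A^\circ,A}$. *)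

(* Defs.v *)
From mathcomp Require Import all_boot.
From Stdlib Require Import ProofIrrelevance.

Set Implicit Arguments.
Unset Strict Implicit.
Unset Printing Implicit Defensive.

Record category := Category {
  obj :> Type;
  hom : obj -> obj -> Type;
  idm : forall X, hom X X;
  cmp : forall X Y Z, hom Y Z -> hom X Y -> hom X Z;
  cmpA : forall X Y Z W (h : hom Z W) (g : hom Y Z) (f : hom X Y),
    cmp h (cmp g f) = cmp (cmp h g) f;
  cmp1m : forall X Y (f : hom X Y), cmp (idm Y) f = f;
  cmpm1 : forall X Y (f : hom X Y), cmp f (idm X) = f }.

Arguments hom {c} X Y.
Arguments idm {c} X.
Arguments cmp {c X Y Z} g f.
Arguments cmpA {c X Y Z W}.
Arguments cmp1m {c X Y}.
Arguments cmpm1 {c X Y}.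

Declare Scope cat_scope.
Delimit Scope cat_scope with cat.
Open Scope cat_scope.

Notation "g \o f" := (cmp g f) : cat_scope.

Definition mono (C : category) (X Y : C) (m : hom X Y) : Prop :=
  forall (Z : C) (f g : hom Z X), m \o f = m \o g -> f = g.

Definition is_iso (C : category) (X Y : C) (f : hom X Y) : Prop :=
  exists g : hom Y X, g \o f = idm X /\ f \o g = idm Y.

Record contra_functor (C D : category) := ContraFunctor {
  cf_obj :> C -> D;
  cf_mor : forall X Y : C, hom X Y -> hom (cf_obj Y) (cf_obj X);
  cf_id : forall X, cf_mor (idm X) = idm (cf_obj X);
  cf_cmp : forall (X Y Z : C) (g : hom Y Z) (f : hom X Y),
    cf_mor (g \o f) = cf_mor f \o cf_mor g }.

Record monoidal := Monoidal {
  mo_cat :> category;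
  one : mo_cat;
  tens : mo_cat -> mo_cat -> mo_cat;
  tensm : forall X X' Y Y' : mo_cat,
    hom X X' -> hom Y Y' -> hom (tens X Y) (tens X' Y');
  tensm1 : forall X Y : mo_cat, tensm (idm X) (idm Y) = idm (tens X Y);
  tensmM : forall (X X' X'' Y Y' Y'' : mo_cat)
      (f' : hom X' X'') (f : hom X X') (g' : hom Y' Y'') (g : hom Y Y'),
    tensm (f' \o f) (g' \o g) = tensm f' g' \o tensm f g;
  assoc : forall X Y Z : mo_cat, hom (tens (tens X Y) Z) (tens X (tens Y Z));
  associ : forall X Y Z : mo_cat, hom (tens X (tens Y Z)) (tens (tens X Y) Z);
  assocK : forall X Y Z, associ X Y Z \o assoc X Y Z = idm _;
  associK : forall X Y Z, assoc X Y Z \o associ X Y Z = idm _;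
  lunit : forall X : mo_cat, hom (tens one X) X;
  luniti : forall X : mo_cat, hom X (tens one X);
  lunitK : forall X, luniti X \o lunit X = idm _;
  lunitiK : forall X, lunit X \o luniti X = idm _;
  runit : forall X : mo_cat, hom (tens X one) X;
  runiti : forall X : mo_cat, hom X (tens X one);
  runitK : forall X, runiti X \o runit X = idm _;
  runitiK : forall X, runit X \o runiti X = idm _;
  assoc_nat : forall (X X' Y Y' Z Z' : mo_cat)
      (f : hom X X') (g : hom Y Y') (h : hom Z Z'),
    assoc X' Y' Z' \o tensm (tensm f g) h
    = tensm f (tensm g h) \o assoc X Y Z;
  lunit_nat : forall (X Y : mo_cat) (f : hom X Y),
    lunit Y \o tensm (idm one) f = f \o lunit X;
  runit_nat : forall (X Y : mo_cat) (f : hom X Y),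
    runit Y \o tensm f (idm one) = f \o runit X;
  pentagon : forall X Y Z W : mo_cat,
    assoc X Y (tens Z W) \o assoc (tens X Y) Z W
    = tensm (idm X) (assoc Y Z W)
      \o (assoc X (tens Y Z) W \o tensm (assoc X Y Z) (idm W));
  triangle : forall X Y : mo_cat,
    tensm (idm X) (lunit Y) \o assoc X one Y = tensm (runit X) (idm Y) }.

Arguments one {m}.
Arguments tens {m} X Y.
Arguments tensm {m X X' Y Y'} f g.
Arguments assoc {m} X Y Z.
Arguments associ {m} X Y Z.
Arguments lunit {m} X.
Arguments luniti {m} X.
Arguments runit {m} X.
Arguments runiti {m} X.

(* [X ⊗ Y] is the tensor product of objects, [f ⊠ g] that of morphisms. *)
Notation "X ⊗ Y" := (tens X Y) (at level 40, left associativity) : cat_scope.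
Notation "f ⊠ g" := (tensm f g) (at level 40, left associativity) : cat_scope.

Record braided := Braided {
  br_mo :> monoidal;
  brd : forall X Y : br_mo, hom (X ⊗ Y) (Y ⊗ X);
  brdi : forall X Y : br_mo, hom (Y ⊗ X) (X ⊗ Y);
  brdK : forall X Y, brdi X Y \o brd X Y = idm _;
  brdiK : forall X Y, brd X Y \o brdi X Y = idm _;
  brd_nat : forall (X X' Y Y' : br_mo) (f : hom X X') (g : hom Y Y'),
    brd X' Y' \o (f ⊠ g) = (g ⊠ f) \o brd X Y;
  hexagon1 : forall X Y Z : br_mo,
    assoc Y Z X \o (brd X (Y ⊗ Z) \o assoc X Y Z)
    = (idm Y ⊠ brd X Z) \o (assoc Y X Z \o (brd X Y ⊠ idm Z));
  hexagon2 : forall X Y Z : br_mo,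
    associ Z X Y \o (brd (X ⊗ Y) Z \o associ X Y Z)
    = (brd X Z ⊠ idm Y) \o (associ X Z Y \o (idm X ⊠ brd Y Z)) }.

Arguments brd {b} X Y.
Arguments brdi {b} X Y.

(* The middle-four interchange [id ⊗ s ⊗ id], with constraints inserted. *)
Definition mid (C : monoidal) (X Y Z W Y' Z' : C) (s : hom (Y ⊗ Z) (Z' ⊗ Y')) :
    hom ((X ⊗ Y) ⊗ (Z ⊗ W)) ((X ⊗ Z') ⊗ (Y' ⊗ W)) :=
  associ X Z' (Y' ⊗ W)
  \o ((idm X ⊠ (assoc Z' Y' W \o ((s ⊠ idm W) \o associ Y Z W)))
  \o assoc X Y (Z ⊗ W)).
Arguments mid {C} X {Y Z} W {Y' Z'} s.

Section Coherence.
Variable C : braided.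
Implicit Types X Y Z W A B T : C.

Lemma cmp_re X Y Z (g : hom Y Z) (f : hom X Y) (h : hom X Z) :
  g \o f = h -> forall W (k : hom W X), g \o (f \o k) = h \o k.
Proof. by move=> <- W k; rewrite cmpA. Qed.

Lemma cancel_l X Y (f : hom X Y) (g : hom Y X) Z (a b : hom Z X) :
  g \o f = idm X -> f \o a = f \o b -> a = b.
Proof. by move=> gf e; rewrite -[a]cmp1m -[b]cmp1m -gf -!cmpA e. Qed.

Lemma cancel_r X Y (f : hom X Y) (g : hom Y X) Z (a b : hom Y Z) :
  f \o g = idm Y -> a \o f = b \o f -> a = b.
Proof. by move=> fg e; rewrite -[a]cmpm1 -[b]cmpm1 -fg !cmpA e. Qed.

Lemma tensm_l X Y Z T (g : hom Y Z) (f : hom X Y) :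
  (g ⊠ idm T) \o (f ⊠ idm T) = (g \o f) ⊠ idm T.
Proof. by rewrite -tensmM cmp1m. Qed.

Lemma tensm_r X Y Z T (g : hom Y Z) (f : hom X Y) :
  (idm T ⊠ g) \o (idm T ⊠ f) = idm T ⊠ (g \o f).
Proof. by rewrite -tensmM cmp1m. Qed.

Lemma tensm_lr X X' Y Y' (f : hom X X') (g : hom Y Y') :
  (f ⊠ idm Y') \o (idm X ⊠ g) = f ⊠ g.
Proof. by rewrite -tensmM cmp1m cmpm1. Qed.

Lemma tensm_rl X X' Y Y' (f : hom X X') (g : hom Y Y') :
  (idm X' ⊠ g) \o (f ⊠ idm Y) = f ⊠ g.
Proof. by rewrite -tensmM cmp1m cmpm1. Qed.

Lemma tens1_inj X Y (f g : hom X Y) :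
  f ⊠ idm (@one C) = g ⊠ idm one -> f = g.
Proof.
move=> e; apply: (cancel_r (runitiK X)).
by rewrite -!runit_nat e.
Qed.

Lemma one_tens_inj X Y (f g : hom X Y) :
  idm (@one C) ⊠ f = idm one ⊠ g -> f = g.
Proof.
move=> e; apply: (cancel_r (lunitiK X)).
by rewrite -!lunit_nat e.
Qed.

Lemma associ_nat X X' Y Y' Z Z' (f : hom X X') (g : hom Y Y') (h : hom Z Z') :
  associ X' Y' Z' \o (f ⊠ (g ⊠ h)) = ((f ⊠ g) ⊠ h) \o associ X Y Z.
Proof.
apply: (cancel_l (assocK _ _ _)).
by rewrite cmpA associK cmp1m cmpA assoc_nat -cmpA associK cmpm1.
Qed.

Lemma lunit_tens X Y : lunit (X ⊗ Y) \o assoc one X Y = lunit X ⊠ idm Y.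
Proof.
apply: one_tens_inj.
apply: (cancel_r (f := assoc one (one ⊗ X) Y)); first exact: associK.
apply: (cancel_r (f := assoc one one X ⊠ idm Y) (g := associ one one X ⊠ idm Y)).
  by rewrite tensm_l associK tensm1.
rewrite -tensm_r -!cmpA -pentagon cmpA triangle -tensm1 -assoc_nat cmpA -assoc_nat.
by rewrite -cmpA tensm_l triangle.
Qed.

Lemma runit_tens X Y : (idm X ⊠ runit Y) \o assoc X Y one = runit (X ⊗ Y).
Proof.
apply: tens1_inj; apply: (cancel_l (assocK _ _ _)).
rewrite -tensm_l cmpA assoc_nat -triangle -tensm_r -!cmpA -pentagon.
by rewrite cmpA -assoc_nat tensm1 -cmpA triangle.
Qed.

Lemma lunit_one : lunit one = runit one :> hom (one ⊗ one) (@one C).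
Proof.
apply: tens1_inj; rewrite -lunit_tens -triangle; congr (_ \o _).
by apply: (cancel_l (lunitK _)); rewrite lunit_nat.
Qed.

Lemma lunit_brd X : lunit X \o brd X one = runit X.
Proof.
apply: tens1_inj; rewrite -triangle -tensm_l.
apply: (cancel_l (brdK _ _)).
rewrite [RHS]cmpA brd_nat.
have e : brd X (one ⊗ one) \o assoc X one one
  = associ one one X \o ((idm one ⊠ brd X one)
      \o (assoc one X one \o (brd X one ⊠ idm one))).
  by rewrite -hexagon1 cmpA assocK cmp1m.
rewrite -[RHS]cmpA e -(lunit_tens one) -!cmpA (cmp_re (associK _ _ _)) cmp1m.
by rewrite (cmp_re (lunit_nat _)) -cmpA (cmp_re (lunit_tens _ _)).
Qed.

Lemma runit_brd X : runit X \o brd one X = lunit X.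
Proof.
apply: one_tens_inj; rewrite -tensm_r.
apply: (cancel_r (associK _ _ _)); rewrite triangle.
apply: (cancel_l (brdK _ _)).
rewrite [RHS]brd_nat.
have e : brd (one ⊗ one) X
  = assoc X one one \o ((brd one X ⊠ idm one)
      \o (associ one X one \o ((idm one ⊠ brd one X) \o assoc one one X))).
  rewrite (cmpA _ _ (assoc one one X)) [V in _ = _ \o V]cmpA -hexagon2 -!cmpA.
  by rewrite assocK cmpm1 cmpA associK cmp1m.
rewrite e (cmp_re (runit_tens _ _)) (cmp_re (runit_nat _)) -!cmpA.
congr (_ \o _); rewrite -runit_tens -!cmpA (cmp_re (associK _ _ _)) cmp1m.
by [].
Qed.

(* [brdi Z X : X ⊗ Z -> Z ⊗ X] is again a braiding. *)
Lemma brdi_nat X X' Y Y' (f : hom X X') (g : hom Y Y') :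
  brdi Y' X' \o (f ⊠ g) = (g ⊠ f) \o brdi Y X.
Proof.
apply: (cancel_l (brdK _ _)).
by rewrite cmpA brdiK cmp1m cmpA brd_nat -cmpA brdiK cmpm1.
Qed.

Lemma lunit_brdi X : lunit X \o brdi one X = runit X.
Proof. by rewrite -runit_brd -cmpA brdiK cmpm1. Qed.

Lemma runit_brdi X : runit X \o brdi X one = lunit X.
Proof. by rewrite -lunit_brd -cmpA brdiK cmpm1. Qed.

Lemma hexagon1i X Y Z :
  assoc Y Z X \o (brdi (Y ⊗ Z) X \o assoc X Y Z)
  = (idm Y ⊠ brdi Z X) \o (assoc Y X Z \o (brdi Y X ⊠ idm Z)).
Proof.
pose p := (brd Y X ⊠ idm Z) \o (associ Y X Z \o (idm Y ⊠ brd Z X)).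
apply: (cancel_l (f := p)
  (g := (idm Y ⊠ brdi Z X) \o (assoc Y X Z \o (brdi Y X ⊠ idm Z)))).
  rewrite /p -!cmpA (cmp_re (tensm_l _ _ _)) brdK tensm1 cmp1m.
  by rewrite (cmp_re (associK _ _ _)) cmp1m tensm_r brdK tensm1.
transitivity (idm ((X ⊗ Y) ⊗ Z)).
  rewrite /p -hexagon2 -!cmpA (cmp_re (assocK _ _ _)) cmp1m.
  by rewrite (cmp_re (brdiK _ _)) cmp1m assocK.
rewrite /p -!cmpA (cmp_re (tensm_r _ _ _)) brdiK tensm1 cmp1m.
by rewrite (cmp_re (assocK _ _ _)) cmp1m tensm_l brdiK tensm1.
Qed.

Lemma hexagon2i X Y Z :
  associ Z X Y \o (brdi Z (X ⊗ Y) \o associ X Y Z)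
  = (brdi Z X ⊠ idm Y) \o (associ X Z Y \o (idm X ⊠ brdi Z Y)).
Proof.
pose p := (idm X ⊠ brd Z Y) \o (assoc X Z Y \o (brd Z X ⊠ idm Y)).
apply: (cancel_l (f := p)
  (g := (brdi Z X ⊠ idm Y) \o (associ X Z Y \o (idm X ⊠ brdi Z Y)))).
  rewrite /p -!cmpA (cmp_re (tensm_r _ _ _)) brdK tensm1 cmp1m.
  by rewrite (cmp_re (assocK _ _ _)) cmp1m tensm_l brdK tensm1.
transitivity (idm (X ⊗ (Y ⊗ Z))).
  rewrite /p -hexagon1 -!cmpA (cmp_re (associK _ _ _)) cmp1m.
  by rewrite (cmp_re (brdiK _ _)) cmp1m associK.
rewrite /p -!cmpA (cmp_re (tensm_l _ _ _)) brdiK tensm1 cmp1m.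
by rewrite (cmp_re (associK _ _ _)) cmp1m tensm_r brdiK tensm1.
Qed.

Definition swap Y A T : hom (Y ⊗ (A ⊗ T)) (A ⊗ (Y ⊗ T)) :=
  locked (assoc A Y T \o ((brdi A Y ⊠ idm T) \o associ Y A T)).

Lemma midE X Y A B :
  mid X B (brdi A Y)
  = associ X A (Y ⊗ B) \o ((idm X ⊠ swap Y A B) \o assoc X Y (A ⊗ B)).
Proof. by rewrite /swap -lock. Qed.

Lemma swap_nat Y Y' A A' T T' (f : hom Y Y') (g : hom A A') (h : hom T T') :
  swap Y' A' T' \o (f ⊠ (g ⊠ h)) = (g ⊠ (f ⊠ h)) \o swap Y A T.
Proof.
rewrite /swap -!lock -!cmpA associ_nat (cmp_re (esym (tensmM _ _ _ _))) brdi_nat cmp1m.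
by rewrite -[h in (_ \o _) ⊠ h]cmpm1 tensmM -!cmpA (cmp_re (assoc_nat _ _ _)) -cmpA.
Qed.

Lemma pentagon_i X Y Z W :
  assoc (X ⊗ Y) Z W \o (associ X Y Z ⊠ idm W)
  = associ X Y (Z ⊗ W) \o ((idm X ⊠ assoc Y Z W) \o assoc X (Y ⊗ Z) W).
Proof.
apply: (cancel_l (assocK _ _ _)).
rewrite !cmpA associK cmp1m pentagon -!cmpA tensm_l associK tensm1 cmpm1.
by [].
Qed.

Lemma pentagon_ii X Y Z W :
  associ X (Y ⊗ Z) W \o (idm X ⊠ associ Y Z W)
  = (assoc X Y Z ⊠ idm W) \o (associ (X ⊗ Y) Z W \o associ X Y (Z ⊗ W)).
Proof.
apply: (cancel_l (assocK _ _ _)).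
rewrite cmpA associK cmp1m.
apply: (cancel_l (f := idm X ⊠ assoc Y Z W) (g := idm X ⊠ associ Y Z W)).
  by rewrite tensm_r assocK tensm1.
rewrite tensm_r associK tensm1.
rewrite [_ \o (assoc _ _ _ ⊠ _ \o _)]cmpA [RHS]cmpA -pentagon -!cmpA.
by rewrite (cmp_re (associK _ _ _)) cmp1m associK.
Qed.

Lemma pentagon_re X Y Z W V (k : hom V (X ⊗ Y ⊗ Z ⊗ W)) :
  (idm X ⊠ assoc Y Z W) \o (assoc X (Y ⊗ Z) W \o ((assoc X Y Z ⊠ idm W) \o k))
  = assoc X Y (Z ⊗ W) \o (assoc (X ⊗ Y) Z W \o k).
Proof. by rewrite [RHS]cmpA pentagon -!cmpA. Qed.

Lemma swap_whisk Y A B T :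
  (idm A ⊠ assoc Y B T) \o (assoc A (Y ⊗ B) T \o (swap Y A B ⊠ idm T))
  = swap Y A (B ⊗ T) \o ((idm Y ⊠ assoc A B T) \o assoc Y (A ⊗ B) T).
Proof.
rewrite /swap -!lock -!tensm_l -!cmpA.
rewrite pentagon_re; congr (_ \o _).
by rewrite (cmp_re (assoc_nat _ _ _)) tensm1 -!cmpA pentagon_i.
Qed.

Lemma swap_tensr Z A B W :
  assoc A B (Z ⊗ W) \o swap Z (A ⊗ B) W
  = (idm A ⊠ swap Z B W) \o (swap Z A (B ⊗ W) \o (idm Z ⊠ assoc A B W)).
Proof.
apply: (cancel_r (f := assoc Z (A ⊗ B) W)); first exact: associK.
apply: (cancel_r (f := assoc Z A B ⊠ idm W) (g := associ Z A B ⊠ idm W)).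
  by rewrite tensm_l associK tensm1.
rewrite /swap -!lock -!cmpA -pentagon (cmp_re (assocK _ _ _)) cmp1m.
rewrite (cmp_re (assocK _ _ _)) cmp1m tensm_l.
rewrite (cmp_re (pentagon _ _ _ _)) -!cmpA tensm_l hexagon1i.
rewrite -!tensm_l (cmp_re (assoc_nat _ _ _)) -!tensm_r -!cmpA.
congr (_ \o _).
congr (_ \o _).
rewrite -tensm1 -assoc_nat (cmp_re (pentagon _ _ _ _)) -!cmpA.
by rewrite (cmp_re (tensm_r _ _ _)) assocK tensm1 cmp1m.
Qed.

Lemma swap_tensl Y Z A W :
  (idm A ⊠ assoc Y Z W) \o swap (Y ⊗ Z) A W
  = swap Y A (Z ⊗ W) \o ((idm Y ⊠ swap Z A W) \o assoc Y Z (A ⊗ W)).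
Proof.
apply: (cancel_r (f := assoc (Y ⊗ Z) A W)); first exact: associK.
apply: (cancel_r (f := associ Y Z A ⊠ idm W) (g := assoc Y Z A ⊠ idm W)).
  by rewrite tensm_l assocK tensm1.
rewrite /swap -!lock -!cmpA (cmp_re (assocK _ _ _)) cmp1m pentagon_i.
rewrite [in RHS](cmp_re (associK _ _ _)) cmp1m.
rewrite (cmp_re (tensm_r _ _ _)) -!cmpA assocK cmpm1.
rewrite -!tensm_r -!cmpA -(assoc_nat (idm Y) (brdi A Z)).
have e : brdi A (Y ⊗ Z) \o associ Y Z A = assoc A Y Z
    \o ((brdi A Y ⊠ idm Z) \o (associ Y A Z \o (idm Y ⊠ brdi A Z))).
  by rewrite -hexagon2i !cmpA associK cmp1m.
rewrite tensm_l e -!tensm_l.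
rewrite pentagon_re (cmp_re (assoc_nat _ _ _)) tensm1 -!cmpA; congr (_ \o (_ \o _)).
by rewrite !cmpA pentagon_i -!cmpA.
Qed.

Lemma mid_assoc X Y Z A B D :
  assoc (X ⊗ A) (Y ⊗ B) (Z ⊗ D)
  \o ((mid X B (brdi A Y) ⊠ idm (Z ⊗ D)) \o mid (X ⊗ Y) D (brdi (A ⊗ B) Z))
  = (idm (X ⊗ A) ⊠ mid Y D (brdi B Z))
    \o (mid X (B ⊗ D) (brdi A (Y ⊗ Z)) \o (assoc X Y Z ⊠ assoc A B D)).
Proof.
pose F := (idm X ⊠ (idm A ⊠ assoc Y B (Z ⊗ D))) \o assoc X A ((Y ⊗ B) ⊗ (Z ⊗ D)).
apply: (cancel_l (f := F)
  (g := associ X A _ \o (idm X ⊠ (idm A ⊠ associ Y B (Z ⊗ D))))).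
  rewrite /F -!cmpA (cmp_re (tensm_r _ _ _)) tensm_r assocK !tensm1 cmp1m.
  by rewrite assocK.
rewrite /F !midE -!tensm_l -!cmpA.
rewrite (cmp_re (pentagon _ _ _ _)) -!cmpA (cmp_re (tensm_l _ _ _)).
rewrite associK tensm1 cmp1m (cmp_re (assoc_nat _ _ _)) -!cmpA.
rewrite (cmp_re (tensm_r _ _ _)) (cmp_re (tensm_r _ _ _)) -cmpA swap_whisk.
rewrite -!tensm_r -!cmpA.
rewrite pentagon_re (cmp_re (associK _ _ _)) cmp1m.
rewrite -(tensm1 X Y) (cmp_re (assoc_nat _ _ _)) -!cmpA.
do 2 rewrite (cmp_re (tensm_r _ _ _)); rewrite -cmpA tensm_r swap_tensr.
rewrite -!(tensm1 X A); do 3 rewrite (cmp_re (assoc_nat _ _ _)) -!cmpA.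
rewrite (cmp_re (associK _ _ _)) cmp1m.
rewrite (cmp_re (tensm_r _ _ _)) tensm_r associK !tensm1 cmp1m.
rewrite (cmp_re (tensm_r _ _ (swap (Y ⊗ Z) _ _))) swap_tensl.
rewrite (cmp_re (tensm_r _ (idm A ⊠ (_ ⊠ _)) _)) (cmp_re (esym (swap_nat _ _ _))).
rewrite -!tensm_r -!cmpA; do 3 congr (_ \o _).
rewrite -[assoc X Y Z ⊠ assoc A B D]tensm_lr pentagon_re.
by rewrite (cmp_re (esym (assoc_nat _ _ _))) -cmpA -assoc_nat !tensm1.
Qed.

Lemma mid_nat X X' Y Y' Z Z' W W' Y1 Y1' Z1 Z1'
    (s : hom (Y ⊗ Z) (Z1 ⊗ Y1)) (s' : hom (Y' ⊗ Z') (Z1' ⊗ Y1'))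
    (f : hom X X') (g : hom Y Y') (h : hom Z Z') (k : hom W W')
    (g1 : hom Y1 Y1') (h1 : hom Z1 Z1') :
  s' \o (g ⊠ h) = (h1 ⊠ g1) \o s ->
  mid X' W' s' \o ((f ⊠ g) ⊠ (h ⊠ k)) = ((f ⊠ h1) ⊠ (g1 ⊠ k)) \o mid X W s.
Proof.
move=> e; rewrite /mid.
have e' : (assoc Z1' Y1' W' \o ((s' ⊠ idm W') \o associ Y' Z' W'))
    \o (g ⊠ (h ⊠ k))
  = (h1 ⊠ (g1 ⊠ k)) \o (assoc Z1 Y1 W \o ((s ⊠ idm W) \o associ Y Z W)).
  rewrite -!cmpA associ_nat [RHS]cmpA -assoc_nat -!cmpA; congr (_ \o _).
  by rewrite !cmpA -!tensmM e cmpm1 cmp1m.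
rewrite -!(cmpA (associ _ _ _)) -!(cmpA (idm _ ⊠ _)) assoc_nat.
rewrite (cmp_re (esym (tensmM _ _ _ _))) e' cmp1m.
rewrite -[f in f ⊠ (_ \o _)]cmpm1 tensmM -!cmpA [LHS]cmpA associ_nat.
by rewrite -!cmpA.
Qed.

Lemma mid_unitl Y D :
  lunit (Y ⊗ D) \o ((lunit one ⊠ idm (Y ⊗ D)) \o mid one D (brdi one Y))
  = lunit Y ⊠ lunit D.
Proof.
rewrite /mid -lunit_tens -!cmpA (cmp_re (associK _ _ _)) cmp1m.
rewrite (cmp_re (lunit_nat _)) -!cmpA lunit_tens.
rewrite (cmp_re (lunit_tens _ _)) (cmp_re (tensm_l _ _ _)) lunit_brdi.
by rewrite -triangle -!cmpA (cmp_re (associK _ _ _)) cmp1m tensm_rl.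
Qed.

Lemma mid_unitr X D :
  runit (X ⊗ D) \o ((idm (X ⊗ D) ⊠ lunit one) \o mid X one (brdi D one))
  = runit X ⊠ runit D.
Proof.
rewrite /mid -(tensm1 X D) (cmp_re (esym (associ_nat _ _ _))).
rewrite -(runit_tens X D) -!cmpA (cmp_re (associK _ _ _)) cmp1m.
do 2 rewrite (cmp_re (tensm_r _ _ _)).
have -> : (runit D \o (idm D ⊠ lunit one)) \o (assoc D one one
    \o ((brdi D one ⊠ idm one) \o associ one D one))
  = lunit D \o (idm one ⊠ runit D).
  rewrite -!cmpA (cmp_re (triangle _ _)) (cmp_re (tensm_l _ _ _)) runit_brdi.
  by rewrite -lunit_tens lunit_nat -!cmpA associK cmpm1 -lunit_nat.
by rewrite -tensm_r -!cmpA -assoc_nat cmpA triangle tensm1 tensm_lr.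
Qed.

End Coherence.

Record monoid (C : monoidal) := MkMonoid {
  mon_ob :> C;
  mmul : hom (mon_ob ⊗ mon_ob) mon_ob;
  munit : hom one mon_ob;
  mmulA : mmul \o (mmul ⊠ idm mon_ob)
    = mmul \o ((idm mon_ob ⊠ mmul) \o assoc mon_ob mon_ob mon_ob);
  mmul1m : mmul \o (munit ⊠ idm mon_ob) = lunit mon_ob;
  mmulm1 : mmul \o (idm mon_ob ⊠ munit) = runit mon_ob }.
Arguments mmul {C} m.
Arguments munit {C} m.

Record comonoid (C : monoidal) := MkComonoid {
  com_ob :> C;
  cdel : hom com_ob (com_ob ⊗ com_ob);
  ceps : hom com_ob one;
  cdelA : assoc com_ob com_ob com_ob \o ((cdel ⊠ idm com_ob) \o cdel)
    = (idm com_ob ⊠ cdel) \o cdel;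
  cdel1m : (ceps ⊠ idm com_ob) \o cdel = luniti com_ob;
  cdelm1 : (idm com_ob ⊠ ceps) \o cdel = runiti com_ob }.
Arguments cdel {C} c.
Arguments ceps {C} c.

Record mon_hom (C : monoidal) (M N : monoid C) := MkMonHom {
  mh_fun :> hom (mon_ob M) (mon_ob N);
  mh_mul : mh_fun \o mmul M = mmul N \o (mh_fun ⊠ mh_fun);
  mh_unit : mh_fun \o munit M = munit N }.

Record comon_hom (C : monoidal) (M N : comonoid C) := MkComonHom {
  ch_fun :> hom (com_ob M) (com_ob N);
  ch_del : cdel N \o ch_fun = (ch_fun ⊠ ch_fun) \o cdel M;
  ch_eps : ceps N \o ch_fun = ceps M }.

Lemma mon_hom_ext (C : monoidal) (M N : monoid C) (f g : mon_hom M N) :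
  mh_fun f = mh_fun g -> f = g.
Proof.
case: f g => [f f1 f2] [g g1 g2] /= e; case: _ / e in g1 g2 *.
by congr MkMonHom; apply: proof_irrelevance.
Qed.

Lemma comon_hom_ext (C : monoidal) (M N : comonoid C) (f g : comon_hom M N) :
  ch_fun f = ch_fun g -> f = g.
Proof.
case: f g => [f f1 f2] [g g1 g2] /= e; case: _ / e in g1 g2 *.
by congr MkComonHom; apply: proof_irrelevance.
Qed.

Section MonCategories.
Variable C : monoidal.

Program Definition mon_id (M : monoid C) : mon_hom M M :=
  @MkMonHom C M M (idm _) _ _.
Next Obligation. by move=> M; rewrite tensm1 cmp1m cmpm1. Qed.
Next Obligation. by move=> M; rewrite cmp1m. Qed.

Program Definition mon_cmp (M N P : monoid C) (g : mon_hom N P) (f : mon_hom M N) :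
  mon_hom M P := @MkMonHom C M P (mh_fun g \o mh_fun f) _ _.
Next Obligation.
by move=> M N P g f; rewrite tensmM cmpA -mh_mul -!cmpA mh_mul.
Qed.
Next Obligation. by move=> M N P g f; rewrite -cmpA !mh_unit. Qed.

Definition Mon : category.
Proof.
apply: (@Category (monoid C) (@mon_hom C) mon_id mon_cmp).
- by move=> *; apply: mon_hom_ext; apply: cmpA.
- by move=> *; apply: mon_hom_ext; apply: cmp1m.
- by move=> *; apply: mon_hom_ext; apply: cmpm1.
Defined.

Program Definition comon_id (M : comonoid C) : comon_hom M M :=
  @MkComonHom C M M (idm _) _ _.
Next Obligation. by move=> M; rewrite tensm1 cmp1m cmpm1. Qed.
Next Obligation. by move=> M; rewrite cmpm1. Qed.

Program Definition comon_cmp (M N P : comonoid C)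
    (g : comon_hom N P) (f : comon_hom M N) : comon_hom M P :=
  @MkComonHom C M P (ch_fun g \o ch_fun f) _ _.
Next Obligation.
by move=> M N P g f; rewrite tensmM cmpA ch_del -!cmpA ch_del.
Qed.
Next Obligation. by move=> M N P g f; rewrite cmpA !ch_eps. Qed.

Definition Comon : category.
Proof.
apply: (@Category (comonoid C) (@comon_hom C) comon_id comon_cmp).
- by move=> *; apply: comon_hom_ext; apply: cmpA.
- by move=> *; apply: comon_hom_ext; apply: cmp1m.
- by move=> *; apply: comon_hom_ext; apply: cmpm1.
Defined.

End MonCategories.

(* [curry] is the inverse of the bijection [f |-> ev A \o (f ⊠ idm A)]. *)
Record prerigid := Prerigid {
  pr_br :> braided;
  dual : pr_br -> pr_br;
  ev : forall A : pr_br, hom (dual A ⊗ A) one;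
  curry : forall B A : pr_br, hom (B ⊗ A) one -> hom B (dual A);
  curryK : forall (B A : pr_br) (p : hom (B ⊗ A) one),
    ev A \o (curry p ⊠ idm A) = p;
  uncurryK : forall (B A : pr_br) (f : hom B (dual A)),
    curry (ev A \o (f ⊠ idm A)) = f }.
Arguments dual {_} A : rename.
Arguments ev {_} A : rename.
Arguments curry {_ B A} h : rename.

Section Dual.
Variable C : prerigid.
Implicit Types A B X Y Z : C.

(* [dualm], [theta], [iota] and [alpha] are the unique morphisms into a dual
   whose pairing under [ev] is the argument of [curry]. *)
Definition dualm A B (f : hom A B) : hom (dual B) (dual A) :=
  curry (ev B \o (idm (dual B) ⊠ f)).

Definition theta A B : hom (dual A ⊗ dual B) (dual (A ⊗ B)) :=
  curry (lunit one \o ((ev A ⊠ ev B) \o mid (dual A) B (brdi A (dual B)))).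

Definition iota : hom (@one C) (dual one) := curry (lunit one).

Definition alpha A : hom A (dual (dual A)) := curry (ev A \o brdi (dual A) A).

Definition vee (A B Q : C) (rho : hom A (B ⊗ Q)) : hom (dual Q ⊗ A) B :=
  runit B \o ((idm B ⊠ ev Q) \o (assoc B (dual Q) Q
    \o ((brd (dual Q) B ⊠ idm Q) \o (associ (dual Q) B Q
    \o (idm (dual Q) ⊠ rho))))).

Lemma curry_inj X A (f g : hom X (dual A)) :
  ev A \o (f ⊠ idm A) = ev A \o (g ⊠ idm A) -> f = g.
Proof. by move=> e; rewrite -[f]uncurryK e uncurryK. Qed.

Lemma ev_dualm A B (f : hom A B) X (g : hom X (dual B)) :
  ev A \o ((dualm f \o g) ⊠ idm A) = ev B \o (g ⊠ f).
Proof. by rewrite -tensm_l cmpA curryK -!cmpA tensm_rl. Qed.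

Lemma dualm1 A : dualm (idm A) = idm (dual A).
Proof.
by apply: curry_inj; rewrite -[dualm _]cmpm1 ev_dualm.
Qed.

Lemma dualmM A B X (g : hom B X) (f : hom A B) :
  dualm (g \o f) = dualm f \o dualm g.
Proof.
apply: curry_inj; rewrite ev_dualm -[dualm (_ \o _)]cmpm1 ev_dualm -tensm_r.
by rewrite cmpA -(ev_dualm g (idm _)) cmpm1 -cmpA tensm_lr.
Qed.

(* The pairing with [D] of a product in the monoid [dual D]: see [ev_dual_mul]. *)
Definition conv (D : comonoid C) X Y (p : hom (X ⊗ D) one) (q : hom (Y ⊗ D) one) :
    hom ((X ⊗ Y) ⊗ D) one :=
  lunit one \o ((p ⊠ q) \o (mid X D (brdi (com_ob D) Y)
    \o (idm (X ⊗ Y) ⊠ cdel D))).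

Definition dual_mul (D : comonoid C) : hom (dual D ⊗ dual D) (dual D) :=
  dualm (cdel D) \o theta D D.
Definition dual_unit (D : comonoid C) : hom one (dual D) :=
  dualm (ceps D) \o iota.

Lemma ev_dual_mul (D : comonoid C) X Y (f : hom X (dual D)) (g : hom Y (dual D)) :
  ev D \o ((dual_mul D \o (f ⊠ g)) ⊠ idm (com_ob D))
  = conv (ev D \o (f ⊠ idm (com_ob D))) (ev D \o (g ⊠ idm (com_ob D))).
Proof.
have : mid (dual D) D (brdi (com_ob D) (dual D)) \o ((f ⊠ g) ⊠ idm (D ⊗ D))
    = ((f ⊠ idm (com_ob D)) ⊠ (g ⊠ idm (com_ob D)))
      \o mid X D (brdi (com_ob D) Y).
  by rewrite -tensm1; apply: mid_nat; rewrite brdi_nat.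
have := curryK (lunit one
  \o ((ev D ⊠ ev D) \o mid (dual D) D (brdi (com_ob D) (dual D)))).
rewrite -/(theta D D) /conv /dual_mul -cmpA ev_dualm.
move: (mid _ _ _) (mid _ _ _) => m m' e1 e2.
rewrite -[_ ⊠ cdel D]tensm_lr -tensm_l -!cmpA (cmp_re e1) -!cmpA (cmp_re e2).
by rewrite tensmM -!cmpA.
Qed.

Lemma conv_assoc (D : comonoid C) X Y Z (p : hom (X ⊗ D) one)
    (q : hom (Y ⊗ D) one) (r : hom (Z ⊗ D) one) :
  conv (conv p q) r = conv p (conv q r) \o (assoc X Y Z ⊠ idm (com_ob D)).
Proof.
have := mid_assoc X Y Z (com_ob D) (com_ob D) (com_ob D).
have : ((idm (X ⊗ Y) ⊠ cdel D) ⊠ (idm Z ⊠ idm (com_ob D)))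
    \o mid (X ⊗ Y) D (brdi (com_ob D) Z)
  = mid (X ⊗ Y) D (brdi (D ⊗ D) Z)
    \o ((idm (X ⊗ Y) ⊠ idm Z) ⊠ (cdel D ⊠ idm (com_ob D))).
  by apply/esym/mid_nat; rewrite brdi_nat.
have : ((idm X ⊠ idm (com_ob D)) ⊠ (idm (Y ⊗ Z) ⊠ cdel D))
    \o mid X D (brdi (com_ob D) (Y ⊗ Z))
  = mid X (D ⊗ D) (brdi (com_ob D) (Y ⊗ Z))
    \o ((idm X ⊠ idm (Y ⊗ Z)) ⊠ (idm (com_ob D) ⊠ cdel D)).
  by apply/esym/mid_nat; rewrite brdi_nat.
rewrite /conv !tensm1.
move: (mid X D (brdi (com_ob D) Y)) (mid Y D _) (mid (X ⊗ Y) _ _) (mid X _ _).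
move: (mid (X ⊗ Y) _ _) (mid X _ _) => m1 m2 m3 m4 m5 m6 e1 e2 e3.
have -> : (lunit one \o ((p ⊠ q) \o (m3 \o (idm (X ⊗ Y) ⊠ cdel D)))) ⊠ r
  = (lunit one ⊠ idm one) \o (((p ⊠ q) ⊠ r) \o ((m3 ⊠ idm (Z ⊗ D))
      \o ((idm (X ⊗ Y) ⊠ cdel D) ⊠ idm (Z ⊗ D)))).
  by rewrite tensm_l -tensmM cmpm1 -tensmM cmp1m.
have -> : p ⊠ (lunit one \o ((q ⊠ r) \o (m4 \o (idm (Y ⊗ Z) ⊠ cdel D))))
  = (idm one ⊠ lunit one) \o ((p ⊠ (q ⊠ r)) \o ((idm (X ⊗ D) ⊠ m4)
      \o (idm (X ⊗ D) ⊠ (idm (Y ⊗ Z) ⊠ cdel D)))).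
  by rewrite tensm_r -tensmM cmpm1 -tensmM cmp1m.
rewrite -!cmpA (cmp_re e2) (cmp_re e1) -!cmpA.
rewrite (cmp_re (tensm_r _ _ _)) tensm_r -cdelA.
rewrite tensm_rl -[in RHS](cmpm1 (assoc X Y Z)) [in RHS]tensmM.
rewrite [X in _ \o X = _]cmpA.
have -> V (k : hom V _) : (idm (X ⊗ D) ⊠ m4)
    \o (m2 \o ((assoc X Y Z ⊠ assoc (com_ob D) (com_ob D) (com_ob D)) \o k))
  = assoc (X ⊗ D) (Y ⊗ D) (Z ⊗ D) \o ((m3 ⊠ idm (Z ⊗ D)) \o (m1 \o k)).
  by rewrite [m2 \o _]cmpA [LHS]cmpA -e3 -!cmpA.
rewrite (cmp_re (esym (assoc_nat _ _ _))) -!cmpA (cmp_re (triangle _ _)).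
by rewrite lunit_one.
Qed.

Lemma conv_nat (D D' : comonoid C) (f : comon_hom D' D) X Y
    (p : hom (X ⊗ D) one) (q : hom (Y ⊗ D) one) :
  conv p q \o (idm (X ⊗ Y) ⊠ ch_fun f)
  = conv (p \o (idm X ⊠ ch_fun f)) (q \o (idm Y ⊠ ch_fun f)).
Proof.
have : ((idm X ⊠ ch_fun f) ⊠ (idm Y ⊠ ch_fun f)) \o mid X D' (brdi (com_ob D') Y)
  = mid X D (brdi (com_ob D) Y) \o ((idm X ⊠ idm Y) ⊠ (ch_fun f ⊠ ch_fun f)).
  by apply/esym/mid_nat; rewrite brdi_nat.
rewrite /conv tensm1; move: (mid _ _ _) (mid _ _ _) => m m' e.
rewrite tensmM -!cmpA (cmp_re e) -!cmpA !tensm_r.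
by rewrite ch_del.
Qed.

Lemma conv_unitl (D : comonoid C) Y (q : hom (Y ⊗ D) one) :
  conv (ceps D \o lunit (com_ob D)) q = q \o (lunit Y ⊠ idm (com_ob D)).
Proof.
have := mid_unitl Y (com_ob D).
have : mid one D (brdi one Y)
    \o ((idm one ⊠ idm Y) ⊠ (ceps D ⊠ idm (com_ob D)))
  = ((idm one ⊠ ceps D) ⊠ (idm Y ⊠ idm (com_ob D)))
      \o mid one D (brdi (com_ob D) Y).
  by apply: mid_nat; rewrite brdi_nat.
rewrite /conv -lunit_nat; move: (mid _ _ _) (mid _ _ _) => m m' e1 e2.
have -> : (lunit one \o (idm one ⊠ ceps D)) ⊠ q
  = (idm one ⊠ q) \o ((lunit one ⊠ idm (Y ⊗ D))
     \o ((idm one ⊠ ceps D) ⊠ (idm Y ⊠ idm (com_ob D)))).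
  by rewrite tensm1 tensm_l tensm_rl.
rewrite -!cmpA (cmp_re (esym e1)) -!cmpA tensm1 tensm_r cdel1m.
rewrite (cmp_re (lunit_nat _)) -!cmpA; congr (_ \o _).
by rewrite [V in _ \o V = _]cmpA cmpA e2 -tensmM lunitiK cmpm1.
Qed.

Lemma conv_unitr (D : comonoid C) X (p : hom (X ⊗ D) one) :
  conv p (ceps D \o lunit (com_ob D)) = p \o (runit X ⊠ idm (com_ob D)).
Proof.
have := mid_unitr X (com_ob D).
have : mid X one (brdi (com_ob D) one)
    \o ((idm X ⊠ idm one) ⊠ (idm (com_ob D) ⊠ ceps D))
  = ((idm X ⊠ idm (com_ob D)) ⊠ (idm one ⊠ ceps D))
      \o mid X D (brdi (com_ob D) one).
  by apply: mid_nat; rewrite brdi_nat.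
rewrite /conv -lunit_nat; move: (mid _ _ _) (mid _ _ _) => m m' e1 e2.
have -> : p ⊠ (lunit one \o (idm one ⊠ ceps D))
  = (p ⊠ idm one) \o ((idm (X ⊗ D) ⊠ lunit one)
     \o ((idm X ⊠ idm (com_ob D)) ⊠ (idm one ⊠ ceps D))).
  by rewrite tensm1 tensm_r tensm_lr.
rewrite -!cmpA (cmp_re (esym e1)) -!cmpA tensm1 tensm_r cdelm1.
rewrite lunit_one (cmp_re (runit_nat _)) -!cmpA; congr (_ \o _).
rewrite lunit_one in e2.
by rewrite [V in _ \o V = _]cmpA cmpA e2 -tensmM runitiK cmpm1.
Qed.

Lemma ev_dual_unit (D : comonoid C) :
  ev D \o (dual_unit D ⊠ idm (com_ob D)) = ceps D \o lunit (com_ob D).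
Proof.
by rewrite ev_dualm -tensm_lr cmpA curryK lunit_nat.
Qed.

Lemma ev1 A : ev A = ev A \o (idm (dual A) ⊠ idm A).
Proof. by rewrite tensm1 cmpm1. Qed.

Lemma ev_dual_mul1 (D : comonoid C) :
  ev D \o (dual_mul D ⊠ idm (com_ob D)) = conv (ev D) (ev D).
Proof. by rewrite -[dual_mul D]cmpm1 -tensm1 ev_dual_mul -ev1. Qed.

Lemma dual_mulA (D : comonoid C) :
  dual_mul D \o (dual_mul D ⊠ idm (dual D))
  = dual_mul D \o ((idm (dual D) ⊠ dual_mul D)
      \o assoc (dual D) (dual D) (dual D)).
Proof.
apply: curry_inj; rewrite ev_dual_mul ev_dual_mul1 -ev1 [dual_mul D \o (_ \o _)]cmpA.
by rewrite -tensm_l cmpA ev_dual_mul ev_dual_mul1 -ev1 conv_assoc.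
Qed.

Lemma dual_mul1m (D : comonoid C) :
  dual_mul D \o (dual_unit D ⊠ idm (dual D)) = lunit (dual D).
Proof.
by apply: curry_inj; rewrite ev_dual_mul ev_dual_unit conv_unitl -ev1.
Qed.

Lemma dual_mulm1 (D : comonoid C) :
  dual_mul D \o (idm (dual D) ⊠ dual_unit D) = runit (dual D).
Proof.
by apply: curry_inj; rewrite ev_dual_mul ev_dual_unit conv_unitr -ev1.
Qed.

Definition dual_mon (D : comonoid C) : Mon C :=
  @MkMonoid C (dual D) (dual_mul D) (dual_unit D)
    (dual_mulA D) (dual_mul1m D) (dual_mulm1 D).

Lemma dualm_mul (D D' : comonoid C) (f : comon_hom D' D) :
  dualm (ch_fun f) \o dual_mul D
  = dual_mul D' \o (dualm (ch_fun f) ⊠ dualm (ch_fun f)).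
Proof.
have e : ev D' \o (dualm (ch_fun f) ⊠ idm (com_ob D')) = ev D \o (idm _ ⊠ ch_fun f).
  by rewrite -[dualm _]cmpm1 ev_dualm.
apply: curry_inj; rewrite ev_dual_mul e ev_dualm -tensm_lr cmpA.
by rewrite ev_dual_mul1 conv_nat.
Qed.

Lemma dualm_unit (D D' : comonoid C) (f : comon_hom D' D) :
  dualm (ch_fun f) \o dual_unit D = dual_unit D'.
Proof. by rewrite /dual_unit cmpA -dualmM ch_eps. Qed.

Definition dual_mor (D' D : Comon C) (f : hom D' D) :
    hom (dual_mon D) (dual_mon D') :=
  @MkMonHom C (dual_mon D) (dual_mon D') (dualm (ch_fun f))
    (dualm_mul f) (dualm_unit f).

Definition dual_functor : contra_functor (Comon C) (Mon C).
Proof.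
apply: (@ContraFunctor (Comon C) (Mon C) dual_mon dual_mor).
- by move=> D; apply: mon_hom_ext; apply: dualm1.
- by move=> D D' D'' g f; apply: mon_hom_ext; apply: dualmM.
Defined.

End Dual.

Record finite_dual (C : prerigid) := FiniteDual {
  fd_fun :> contra_functor (Mon C) (Comon C);
  fd_adj : forall (A : Mon C) (D : Comon C),
    hom A (dual_functor C D) -> hom D (fd_fun A);
  fd_adjV : forall (A : Mon C) (D : Comon C),
    hom D (fd_fun A) -> hom A (dual_functor C D);
  fd_adjK : forall (A : Mon C) (D : Comon C) (f : hom A (dual_functor C D)),
    fd_adjV (fd_adj f) = f;
  fd_adjVK : forall (A : Mon C) (D : Comon C) (g : hom D (fd_fun A)),
    fd_adj (fd_adjV g) = g;
  fd_nat : forall (A A' : Mon C) (D D' : Comon C)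
      (f : hom A' A) (g : hom D' D) (h : hom A (dual_functor C D)),
    fd_adj (cf_mor (dual_functor C) g \o (h \o f))
    = cf_mor fd_fun f \o (fd_adj h \o g) }.

(* [fd_fun] typed with the records themselves, so that the coercions from
   [comonoid C] and [monoid C] to [C] apply; same for [eta]. *)
Definition fdual (C : prerigid) (F : finite_dual C) (A : monoid C) :
  comonoid C := fd_fun F A.

Definition eta (C : prerigid) (F : finite_dual C) (A : monoid C) :
    mon_hom A (dual_mon (fdual F A)) :=
  @fd_adjV C F A (fdual F A) (@idm (Comon C) (fdual F A)).

Definition varkappa (C : prerigid) (F : finite_dual C) (A : monoid C) :
    hom (com_ob (fdual F A)) (dual (mon_ob A)) :=
  curry (ev (com_ob (fdual F A))
    \o ((mh_fun (eta F A) ⊠ idm (com_ob (fdual F A)))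
    \o brd (com_ob (fdual F A)) (mon_ob A))).

(* [tpow A 1] is [one ⊗ A], identified with [A] through [lunit A]. *)
Fixpoint tpow (C : monoidal) (A : C) (n : nat) : C :=
  if n is n'.+1 then tpow A n' ⊗ A else one.

Record omega_magma (C : monoidal) (Om : Type) (s t : Om -> nat) := OmegaMagma {
  om_ob :> C;
  om_op : forall w : Om, hom (tpow om_ob (s w)) (tpow om_ob (t w)) }.
Arguments om_op {C Om s t} o w.

Section Measurings.
Variable C : braided.

Definition meas_tens (P : comonoid C) (A1 B1 A2 B2 : C)
    (psi1 : hom (P ⊗ A1) B1) (psi2 : hom (P ⊗ A2) B2) :
    hom (P ⊗ (A1 ⊗ A2)) (B1 ⊗ B2) :=
  (psi1 ⊠ psi2) \o (mid P A2 (brd (com_ob P) A1)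
    \o (cdel P ⊠ idm (A1 ⊗ A2))).

Fixpoint meas_pow (P : comonoid C) (A B : C) (psi : hom (P ⊗ A) B) (n : nat) :
    hom (P ⊗ tpow A n) (tpow B n) :=
  if n is n'.+1 then meas_tens (meas_pow psi n') psi
  else ceps P \o runit (com_ob P).

Definition comeas_tens (Q : monoid C) (A1 B1 A2 B2 : C)
    (rho1 : hom A1 (B1 ⊗ Q)) (rho2 : hom A2 (B2 ⊗ Q)) :
    hom (A1 ⊗ A2) ((B1 ⊗ B2) ⊗ Q) :=
  (idm (B1 ⊗ B2) ⊠ mmul Q) \o (mid B1 Q (brd (mon_ob Q) B2)
    \o (rho1 ⊠ rho2)).

Fixpoint comeas_pow (Q : monoid C) (A B : C) (rho : hom A (B ⊗ Q)) (n : nat) :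
    hom (tpow A n) (tpow B n ⊗ Q) :=
  if n is n'.+1 then comeas_tens (comeas_pow rho n') rho
  else luniti (mon_ob Q) \o munit Q.

Definition tensor_epi (A B Q : C) (rho : hom A (B ⊗ Q)) : Prop :=
  forall (R : C) (f g : hom Q R),
    (idm B ⊠ f) \o rho = (idm B ⊠ g) \o rho -> f = g.

Variables (Om : Type) (s t : Om -> nat) (A B : omega_magma C s t).

Definition is_measuring (P : comonoid C) (psi : hom (P ⊗ A) B) : Prop :=
  forall w : Om,
    om_op B w \o meas_pow psi (s w)
    = meas_pow psi (t w) \o (idm (com_ob P) ⊠ om_op A w).

Definition is_comeasuring (Q : monoid C) (rho : hom (om_ob A) (B ⊗ Q)) : Prop :=
  forall w : Om,
    comeas_pow rho (t w) \o om_op A w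
    = (om_op B w ⊠ idm (mon_ob Q)) \o comeas_pow rho (s w).

(* Objects of the categories whose initial (terminal) object is the universal
   comeasuring (measuring); the definitions make sense for arbitrary [rhoU] and
   [psiV], not only for tensor epimorphisms and tensor monomorphisms. *)
Definition comeas_below (U : C) (rhoU : hom (om_ob A) (B ⊗ U))
    (Q : monoid C) (rho : hom (om_ob A) (B ⊗ Q)) : Prop :=
  is_comeasuring rho
  /\ exists tau : hom U Q, (idm (om_ob B) ⊠ tau) \o rhoU = rho.

Definition meas_below (V : C) (psiV : hom (V ⊗ A) B)
    (P : comonoid C) (psi : hom (P ⊗ A) B) : Prop :=
  is_measuring psi
  /\ exists tau : hom (com_ob P) V, psiV \o (tau ⊠ idm (om_ob A)) = psi.

Definition is_universal_comeasuring (U : C) (rhoU : hom (om_ob A) (B ⊗ U))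
    (Q : monoid C) (rho : hom (om_ob A) (B ⊗ Q)) : Prop :=
  comeas_below rhoU rho
  /\ forall (Q' : monoid C) (rho' : hom (om_ob A) (B ⊗ Q')),
      comeas_below rhoU rho' ->
      exists! phi : mon_hom Q Q', (idm (om_ob B) ⊠ mh_fun phi) \o rho = rho'.

Definition is_universal_measuring (V : C) (psiV : hom (V ⊗ A) B)
    (P : comonoid C) (psi : hom (P ⊗ A) B) : Prop :=
  meas_below psiV psi
  /\ forall (P' : comonoid C) (psi' : hom (P' ⊗ A) B),
      meas_below psiV psi' ->
      exists! phi : comon_hom P' P, psi \o (ch_fun phi ⊠ idm (om_ob A)) = psi'.

End Measurings.

(* Main.v *)
From mathcomp Require Import ssreflect ssrfun.
Require Import Defs.

Set Implicit Arguments.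
Unset Strict Implicit.
Unset Printing Implicit Defensive.
Open Scope cat_scope.

(** Comeasurings are turned into measurings by one operation: a pairing
    [w : P ⊗ Q -> 1] turns [rho : A -> B ⊗ Q] into
    [vee_along w rho : P ⊗ A -> B] by evaluating [Q] against [P]. It sends
    [rho] to [vee rho] when [w] is the evaluation of [Q].

    For a comonoid [P], the right evaluation [evr P : P ⊗ P^* -> 1] is
    multiplicative for the convolution product of [P^*]
    ([evr_multiplicative]), and along a multiplicative pairing [vee_along]
    carries the tensor powers of [rho] to those of [vee_along w rho]
    ([along_comeas_pow]). Moreover [vee_along (evr P)] is injective
    ([along_evr_inj]): [vee_along (evr P) rho] determines the pairing of
    [A] with [B^* ⊗ P] that [rho] induces through the embedding
    [theta \o (alpha ⊠ id) : B ⊗ P^* -> (B^* ⊗ P)^*]; this is where the two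
    monomorphism hypotheses enter. Hence comeasurings [A -> B ⊗ P^*] and
    measurings [P ⊗ A -> B] correspond to each other ([comeasuring_along]).

    Under this correspondence, [kappa \o (f ⊠ id)], for a comonoid morphism
    [f : P -> AU°], comes from [(id ⊠ f^flat) \o rhoC], where
    [f^flat : AU -> P^*] is the adjoint of [f] ([kappa_along]). So [kappa] is a
    measuring, and it is cancellable: [f^flat] is the only monoid morphism
    inducing its comeasuring from the initial [rhoC]. The factorizations of
    comeasurings through [rhoU] and of measurings through [vee rhoU] correspond
    as well. The universal measuring [psiM] therefore comes from a comeasuring
    with values in [B ⊗ CU^*], which the initial [rhoC] maps to by a monoid
    morphism [AU -> CU^*]; the adjoint [gamma : CU -> AU°] of the latter
    satisfies [kappa \o (gamma ⊠ id) = psiM]. Cancelling [kappa] and [psiM]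
    shows that [gamma] is inverse to [beta]. *)

(** * Moving an object across the first factor of a tensor product *)

(** The facts about [swap] are stated for the inverse braiding; applied to the
    reverse braided category, they give their analogues for the braiding. *)
Definition reverse (C : braided) : braided :=
  @Braided C (fun X Y => brdi Y X) (fun X Y => brd Y X)
    (fun X Y => @brdiK C Y X) (fun X Y => @brdK C Y X)
    (fun X X' Y Y' f g => brdi_nat f g)
    (@hexagon1i C) (@hexagon2i C).

Section Slide.
Variable C : braided.
Implicit Types A B D P Q X Y Z W T : C.

Definition slide P A T : hom (P ⊗ (A ⊗ T)) (A ⊗ (P ⊗ T)) :=
  @swap (reverse C) P A T.

Lemma slideE P A T :
  slide P A T = assoc A P T \o ((brd P A ⊠ idm T) \o associ P A T).
Proof. by rewrite /slide /swap -lock. Qed.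

Lemma mid_slide X Y A B :
  mid X B (brd Y A)
  = associ X A (Y ⊗ B) \o ((idm X ⊠ slide Y A B) \o assoc X Y (A ⊗ B)).
Proof. exact: (@midE (reverse C)). Qed.

Lemma slide_nat P P' A A' T T' (f : hom P P') (g : hom A A') (h : hom T T') :
  slide P' A' T' \o (f ⊠ (g ⊠ h)) = (g ⊠ (f ⊠ h)) \o slide P A T.
Proof. exact: (@swap_nat (reverse C)). Qed.

Lemma slide_whisk P A B T :
  (idm A ⊠ assoc P B T) \o (assoc A (P ⊗ B) T \o (slide P A B ⊠ idm T))
  = slide P A (B ⊗ T) \o ((idm P ⊠ assoc A B T) \o assoc P (A ⊗ B) T).
Proof. exact: (@swap_whisk (reverse C)). Qed.

Lemma slide_tensr P A B T :
  assoc A B (P ⊗ T) \o slide P (A ⊗ B) T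
  = (idm A ⊠ slide P B T) \o (slide P A (B ⊗ T) \o (idm P ⊠ assoc A B T)).
Proof. exact: (@swap_tensr (reverse C)). Qed.

Lemma slide_tensl P Q A T :
  (idm A ⊠ assoc P Q T) \o slide (P ⊗ Q) A T
  = slide P A (Q ⊗ T) \o ((idm P ⊠ slide Q A T) \o assoc P Q (A ⊗ T)).
Proof. exact: (@swap_tensl (reverse C)). Qed.

Lemma slide_one A T :
  (idm A ⊠ lunit T) \o slide one A T = lunit (A ⊗ T).
Proof.
rewrite slideE (cmp_re (triangle _ _)) (cmp_re (tensm_l _ _ _)) runit_brd.
by rewrite -lunit_tens -cmpA associK cmpm1.
Qed.

Lemma slide_runit P A :
  (idm A ⊠ runit P) \o slide P A one = brd P A \o (idm P ⊠ runit A).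
Proof.
rewrite slideE (cmp_re (runit_tens _ _)) (cmp_re (runit_nat _)) -runit_tens.
by rewrite -!cmpA associK cmpm1.
Qed.

Lemma brd_slide P A T :
  assoc A T P \o brd P (A ⊗ T) = (idm A ⊠ brd P T) \o slide P A T.
Proof.
apply: (cancel_r (associK _ _ _)).
rewrite -cmpA hexagon1 slideE -!cmpA assocK cmpm1.
by [].
Qed.

Lemma brd_tensl P Q A :
  brd (P ⊗ Q) A = slide P A Q \o ((idm P ⊠ brd Q A) \o assoc P Q A).
Proof.
apply: (cancel_r (assocK _ _ _)); apply: (cancel_l (associK _ _ _)).
rewrite hexagon2 slideE -!cmpA (cmp_re (assocK _ _ _)) cmp1m associK.
by rewrite cmpm1.
Qed.

Lemma slide_swap P A T : swap A P T \o slide P A T = idm _.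
Proof.
rewrite slideE /swap -lock -!cmpA (cmp_re (assocK _ _ _)) cmp1m.
rewrite (cmp_re (tensm_l _ _ _)) brdK tensm1 cmp1m associK.
by [].
Qed.

(** The braiding of [P ⊗ P'] with [Q ⊗ Q'] crosses each of [P], [P'] with each
    of [Q], [Q']; the inverse braiding undoes the crossing of [P] with [Q']. This
    is how the inverse braiding in the convolution product becomes the braiding
    in the tensor product of measurings. *)
Lemma mid_brd P P' Q Q' :
  mid Q P' (brdi P Q') \o brd (P ⊗ P') (Q ⊗ Q')
  = (brd P Q ⊠ brd P' Q') \o mid P Q' (brd P' Q).
Proof.
rewrite midE mid_slide -!cmpA brd_slide brd_tensl -!tensm_r -!cmpA.
rewrite slide_tensl (cmp_re (tensm_r _ _ _)) slide_swap tensm1 cmp1m.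
rewrite slideE -!cmpA (cmp_re (esym (assoc_nat _ _ _))) -!cmpA.
by rewrite (cmp_re (assocK _ _ _)) cmp1m tensm1 (cmp_re (tensm_rl _ _)).
Qed.

Lemma slide_yang_baxter P Q B T :
  (idm B ⊠ slide P Q T) \o (slide P B (Q ⊗ T) \o (idm P ⊠ slide Q B T))
  = slide Q B (P ⊗ T) \o ((idm Q ⊠ slide P B T) \o slide P Q (B ⊗ T)).
Proof.
apply: (cancel_r (f := idm P ⊠ assoc Q B T) (g := idm P ⊠ associ Q B T)).
  by rewrite tensm_r associK tensm1.
rewrite -!cmpA -slide_tensr.
rewrite [slide Q B T]slideE -!tensm_r -!cmpA.
rewrite [idm P ⊠ associ _ _ _ \o _]tensm_r assocK tensm1 cmpm1.
rewrite [slide P B _ \o _]cmpA [LHS]cmpA -slide_tensr -!cmpA slide_nat.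
by rewrite [slide Q B _]slideE -!cmpA (cmp_re (assocK _ _ _)) cmp1m tensm1.
Qed.

(** * Transposing along a pairing *)

Definition vee_along P B Q X (w : hom (P ⊗ Q) one) (rho : hom X (B ⊗ Q)) :
    hom (P ⊗ X) B :=
  runit B \o ((idm B ⊠ w) \o (slide P B Q \o (idm P ⊠ rho))).

(** [mid_pair_tens] with the first output factor removed: [Q] and [P']
    cross [B] in either order, and since the pairing of [P] with [Q] ends in the
    unit, crossing [B] after pairing costs nothing. *)
Lemma slide_pair_tens P P' Q Q' B (w : hom (P ⊗ Q) one) (w' : hom (P' ⊗ Q') one) :
  runit B \o ((idm B ⊠ (lunit one \o ((w ⊠ w') \o mid P Q' (brd P' Q))))
    \o (slide (P ⊗ P') B (Q ⊗ Q') \o (idm (P ⊗ P') ⊠ slide Q B Q')))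
  = lunit B \o ((w ⊠ idm B) \o (associ P Q B
    \o ((idm P ⊠ ((idm Q ⊠ (runit B \o ((idm B ⊠ w') \o slide P' B Q')))
        \o slide P' Q (B ⊗ Q'))) \o assoc P P' (Q ⊗ (B ⊗ Q'))))).
Proof.
rewrite mid_slide -!tensm_r -!cmpA.
rewrite (cmp_re (slide_tensl _ _ _ _)) -!cmpA.
rewrite -(tensm1 P P') assoc_nat.
rewrite (cmp_re (esym (slide_nat _ _ _))) -!cmpA.
have yb V (k : hom V _) : (idm P ⊠ (idm B ⊠ slide P' Q Q'))
    \o ((idm P ⊠ slide P' B (Q ⊗ Q'))
    \o ((idm P ⊠ (idm P' ⊠ slide Q B Q')) \o k))
  = (idm P ⊠ slide Q B (P' ⊗ Q')) \o ((idm P ⊠ (idm Q ⊠ slide P' B Q'))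
    \o ((idm P ⊠ slide P' Q (B ⊗ Q')) \o k)).
  by rewrite !cmpA !tensm_r -!cmpA slide_yang_baxter.
rewrite yb.
have e V (k : hom V _) : slide P B (Q ⊗ (P' ⊗ Q'))
    \o ((idm P ⊠ slide Q B (P' ⊗ Q')) \o k)
  = (idm B ⊠ assoc P Q (P' ⊗ Q')) \o (slide (P ⊗ Q) B (P' ⊗ Q')
    \o (associ P Q (B ⊗ (P' ⊗ Q')) \o k)).
  rewrite (cmp_re (slide_tensl _ _ _ _)) -!cmpA (cmp_re (associK _ _ _)).
  by rewrite cmp1m.
rewrite e (cmp_re (tensm_r _ (associ _ _ _) _)) assocK tensm1 cmp1m.
rewrite (cmp_re (esym (slide_nat _ _ _))) -!cmpA.
rewrite (cmp_re (slide_one _ _)) (cmp_re (esym (lunit_nat _))) -!cmpA.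
congr (_ \o _).
do 4 rewrite (cmp_re (associ_nat _ _ _)) -!cmpA tensm1.
do 4 rewrite (cmp_re (esym (tensmM _ _ _ _))) ?cmp1m ?cmpm1.
by rewrite (cmp_re (esym (tensmM _ _ _ _))) cmpm1 -!cmpA.
Qed.

(** Both sides join [P] to [Q] and [P'] to [Q'] along isotopic strings. On either
    side [P ⊗ P'] can be taken past [B] before anything else happens; what
    remains is [slide_pair_tens] for [B']. *)
Lemma mid_pair_tens P P' Q Q' B B'
    (w : hom (P ⊗ Q) one) (w' : hom (P' ⊗ Q') one) :
  runit (B ⊗ B')
    \o ((idm (B ⊗ B') ⊠ (lunit one \o ((w ⊠ w') \o mid P Q' (brd P' Q))))
    \o (slide (P ⊗ P') (B ⊗ B') (Q ⊗ Q')
    \o (idm (P ⊗ P') ⊠ mid B Q' (brd Q B'))))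
  = ((runit B \o ((idm B ⊠ w) \o slide P B Q))
     ⊠ (runit B' \o ((idm B' ⊠ w') \o slide P' B' Q')))
    \o mid P (B' ⊗ Q') (brd P' (B ⊗ Q)).
Proof.
(* Both are kept opaque, or else the distribution of [⊠] over [\o] below would
   split them. *)
move epr : (runit B' \o ((idm B' ⊠ w') \o slide P' B' Q')) => pr'.
move eX : (lunit one \o ((w ⊠ w') \o mid P Q' (brd P' Q))) => X.
transitivity ((idm B ⊠ (runit B' \o ((idm B' ⊠ X)
    \o (slide (P ⊗ P') B' (Q ⊗ Q') \o (idm (P ⊗ P') ⊠ slide Q B' Q')))))
  \o (slide (P ⊗ P') B (Q ⊗ (B' ⊗ Q')) \o (idm _ ⊠ assoc B Q (B' ⊗ Q')))).
  rewrite mid_slide -!tensm_r -!cmpA -runit_tens -!cmpA.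
  rewrite -(tensm1 B B') (cmp_re (assoc_nat _ _ _)) -!cmpA.
  rewrite (cmp_re (slide_tensr _ _ _ _)) -!cmpA.
  rewrite (cmp_re (tensm_r _ _ (associ _ _ _))) associK tensm1 cmp1m.
  by rewrite (cmp_re (slide_nat _ _ _)) -!cmpA.
rewrite -eX slide_pair_tens epr -!tensm_r -!cmpA.
rewrite (cmp_re (slide_tensl _ _ _ _)) -!cmpA.
rewrite mid_slide.
have -> : slide P' (B ⊗ Q) (B' ⊗ Q') = associ B Q (P' ⊗ (B' ⊗ Q'))
    \o ((idm B ⊠ slide P' Q (B' ⊗ Q')) \o (slide P' B (Q ⊗ (B' ⊗ Q'))
    \o (idm P' ⊠ assoc B Q (B' ⊗ Q')))).
  by rewrite -slide_tensr cmpA assocK cmp1m.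
rewrite -[(runit B \o _) ⊠ pr']tensm_lr -!cmpA.
rewrite -[idm (P ⊗ (B ⊗ Q))]tensm1 (cmp_re (esym (associ_nat _ _ _))) -!cmpA.
rewrite -!tensm_r -!cmpA.
have h V (k : hom V _) : (idm P ⊠ (idm (B ⊗ Q) ⊠ pr'))
    \o ((idm P ⊠ associ B Q (P' ⊗ (B' ⊗ Q'))) \o k)
  = (idm P ⊠ associ B Q B') \o ((idm P ⊠ (idm B ⊠ (idm Q ⊠ pr'))) \o k).
  by rewrite !(cmp_re (tensm_r _ _ _)) associ_nat tensm1.
rewrite h {h}.
have e V (k : hom V _) : (slide P B Q ⊠ idm B') \o (associ P (B ⊗ Q) B'
    \o ((idm P ⊠ associ B Q B') \o k))
  = associ B (P ⊗ Q) B' \o ((idm B ⊠ associ P Q B') \o (slide P B (Q ⊗ B') \o k)).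
  apply: (cancel_l (assocK _ _ _)); rewrite (cmp_re (associK _ _ _)) cmp1m.
  apply: (cancel_l (f := idm B ⊠ assoc P Q B') (g := idm B ⊠ associ P Q B')).
    by rewrite tensm_r assocK tensm1.
  rewrite (cmp_re (tensm_r _ _ _)) associK tensm1 cmp1m.
  rewrite [assoc _ _ _ \o (_ \o _)]cmpA [LHS]cmpA slide_whisk -!cmpA.
  rewrite (cmp_re (associK _ _ _)) cmp1m (cmp_re (tensm_r _ _ _)) associK tensm1.
  by rewrite cmp1m.
rewrite -!tensm_l -!cmpA e.
rewrite (cmp_re (esym (associ_nat _ _ _))) -!cmpA.
rewrite -triangle -!cmpA (cmp_re (associK _ _ _)) cmp1m.
do 3 congr (_ \o _).
rewrite (cmp_re (esym (slide_nat _ _ _))) -!cmpA.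
rewrite (cmp_re (esym (slide_nat _ _ _))) -!cmpA.
rewrite -(tensm1 P P') assoc_nat.
by [].
Qed.

Lemma slide_unit P T : lunit (P ⊗ T) \o slide P one T = idm P ⊠ lunit T.
Proof.
rewrite slideE (cmp_re (lunit_tens _ _)) (cmp_re (tensm_l _ _ _)) lunit_brd.
by rewrite -triangle -cmpA associK cmpm1.
Qed.

Lemma along_pushr P B Q Q' X (w : hom (P ⊗ Q') one) (f : hom Q Q')
    (rho : hom X (B ⊗ Q)) :
  vee_along w ((idm B ⊠ f) \o rho) = vee_along (w \o (idm P ⊠ f)) rho.
Proof.
by rewrite /vee_along -tensm_r (cmp_re (slide_nat _ _ _)) -tensm_r -!cmpA.
Qed.

Lemma along_pushl P B B' Q X (w : hom (P ⊗ Q) one) (g : hom B B')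
    (rho : hom X (B ⊗ Q)) :
  vee_along w ((g ⊠ idm Q) \o rho) = g \o vee_along w rho.
Proof.
rewrite /vee_along -tensm_r (cmp_re (slide_nat _ _ _)) tensm1 -!cmpA.
rewrite (cmp_re (esym (tensmM _ _ _ _))) cmpm1 cmp1m.
by rewrite (cmp_re (esym (runit_nat _))) -!cmpA (cmp_re (tensm_lr _ _)).
Qed.

Lemma along_prel P P' B Q X (w : hom (P' ⊗ Q) one) (f : hom P P')
    (rho : hom X (B ⊗ Q)) :
  vee_along (w \o (f ⊠ idm Q)) rho = vee_along w rho \o (f ⊠ idm X).
Proof.
rewrite /vee_along -tensm_r -!cmpA (cmp_re (esym (slide_nat _ _ _))) tensm1.
by rewrite -!cmpA tensm_lr tensm_rl.
Qed.

Lemma along_prer P B Q X Y (w : hom (P ⊗ Q) one) (rho : hom X (B ⊗ Q))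
    (h : hom Y X) :
  vee_along w (rho \o h) = vee_along w rho \o (idm P ⊠ h).
Proof. by rewrite /vee_along -tensm_r -!cmpA. Qed.

Lemma along_unit P Q X (w : hom (P ⊗ Q) one) (q : hom X Q) :
  vee_along w (luniti Q \o q) = w \o (idm P ⊠ q).
Proof.
rewrite /vee_along -lunit_one (cmp_re (lunit_nat _)) -!cmpA.
rewrite (cmp_re (slide_unit _ _)) tensm_r cmpA lunitiK.
by rewrite cmp1m.
Qed.

Lemma along_tens P P' Q Q' B B' X X' (w : hom (P ⊗ Q) one)
    (w' : hom (P' ⊗ Q') one) (rho : hom X (B ⊗ Q)) (rho' : hom X' (B' ⊗ Q')) :
  vee_along (lunit one \o ((w ⊠ w') \o mid P Q' (brd P' Q)))
    (mid B Q' (brd Q B') \o (rho ⊠ rho'))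
  = (vee_along w rho ⊠ vee_along w' rho') \o mid P X' (brd P' X).
Proof.
have e : mid P (B' ⊗ Q') (brd P' (B ⊗ Q)) \o ((idm P ⊠ idm P') ⊠ (rho ⊠ rho'))
  = ((idm P ⊠ rho) ⊠ (idm P' ⊠ rho')) \o mid P X' (brd P' X).
  by apply: mid_nat; rewrite brd_nat.
rewrite along_prer {1}/vee_along mid_pair_tens -cmpA -(tensm1 P P') e.
by rewrite [LHS]cmpA -tensmM /vee_along -!cmpA.
Qed.

(** In the notation [<p, q>]: [<p, x y> = <p_1, x> <p_2, y>] and
    [<p, 1> = ceps p], that is, [w] is a measuring from [Q] to the unit monoid. *)
Definition multiplicative (P : comonoid C) (Q : monoid C)
    (w : hom (P ⊗ Q) one) : Prop :=
  w \o (idm (com_ob P) ⊠ mmul Q) = lunit one \o meas_tens w w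
  /\ w \o (idm (com_ob P) ⊠ munit Q) = ceps P \o runit (com_ob P).

(** Multiplicativity replaces the product of [Q] in [comeas_tens] by the
    coproduct of [P] in [meas_tens]. *)
Lemma along_comeas_pow (P : comonoid C) (Q : monoid C) A B
    (w : hom (P ⊗ Q) one) (rho : hom A (B ⊗ Q)) n :
  multiplicative w -> vee_along w (comeas_pow rho n) = meas_pow (vee_along w rho) n.
Proof.
move=> [wM w1]; elim: n => [|n IHn] /=; first by rewrite along_unit.
rewrite -IHn /comeas_tens along_pushr wM /meas_tens.
rewrite (cmpA (w ⊠ w)) cmpA along_prel along_tens -!cmpA.
by [].
Qed.

Lemma comeas_pow_push (Q Q' : monoid C) (phi : mon_hom Q Q') A B
    (rho : hom A (B ⊗ Q)) n :
  comeas_pow ((idm B ⊠ mh_fun phi) \o rho) n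
  = (idm (tpow B n) ⊠ mh_fun phi) \o comeas_pow rho n.
Proof.
elim: n => [|n IHn] /=.
  rewrite -(mh_unit phi); apply: (cancel_l (lunitK _)).
  by rewrite (cmp_re (lunit_nat _)) -!cmpA !(cmp_re (lunitiK _)) !cmp1m.
rewrite IHn /comeas_tens tensmM.
have e : mid (tpow B n) Q' (brd (mon_ob Q') B)
    \o ((idm (tpow B n) ⊠ mh_fun phi) ⊠ (idm B ⊠ mh_fun phi))
  = ((idm (tpow B n) ⊠ idm B) ⊠ (mh_fun phi ⊠ mh_fun phi))
    \o mid (tpow B n) Q (brd (mon_ob Q) B).
  by apply: mid_nat; rewrite brd_nat.
rewrite (cmp_re e) -!cmpA tensm1 !(cmp_re (tensm_r _ _ _)).
by rewrite mh_mul.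
Qed.

Lemma comeasuring_push (Om : Type) (s t : Om -> nat)
    (A B : omega_magma C s t) (Q Q' : monoid C) (phi : mon_hom Q Q')
    (rho : hom (om_ob A) (B ⊗ Q)) :
  is_comeasuring rho -> is_comeasuring ((idm (om_ob B) ⊠ mh_fun phi) \o rho).
Proof.
move=> h w; rewrite !comeas_pow_push -cmpA h (cmp_re (tensm_rl _ _)).
by rewrite (cmp_re (tensm_lr _ _)).
Qed.

End Slide.

(** * Comeasurings with values in a dual monoid *)

Section Evaluation.
Variable C : prerigid.
Implicit Types A B D X U : C.

Definition evr D : hom (D ⊗ dual D) one := ev D \o brd D (dual D).

Lemma evr_mor D X (f : hom X (dual D)) :
  evr D \o (idm D ⊠ f) = (ev D \o (f ⊠ idm D)) \o brd D X.
Proof. by rewrite /evr -!cmpA brd_nat. Qed.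

Definition curryr D X (w : hom (D ⊗ X) one) : hom X (dual D) :=
  curry (w \o brdi D X).

Lemma curryrK D X (w : hom (D ⊗ X) one) : evr D \o (idm D ⊠ curryr w) = w.
Proof. by rewrite evr_mor curryK -cmpA brdK cmpm1. Qed.

Lemma evr_multiplicative (D : comonoid C) :
  @multiplicative C D (dual_mon D) (evr D).
Proof.
split; rewrite evr_mor /=.
  have := mid_brd (com_ob D) D (dual D) (dual D).
  rewrite ev_dual_mul1 /conv /meas_tens /evr tensmM.
  (* [mid] unfolds to a composite, which [-!cmpA] would take apart. *)
  move: (mid _ _ _) (mid _ _ _) => m m' e.
  by rewrite -!cmpA -brd_nat (cmp_re e) -!cmpA.
by rewrite ev_dual_unit -cmpA lunit_brd.
Qed.

Lemma veeE A B U (rho : hom A (B ⊗ U)) : vee rho = vee_along (ev U) rho.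
Proof. by rewrite /vee /vee_along slideE -!cmpA. Qed.

(** All of [B ⊗ dual D] crosses [D], so the braidings can be performed last on
    the source side, where they are invertible. *)
Lemma along_evr A B D (rho : hom A (B ⊗ dual D)) :
  vee_along (evr D) rho
  = (runit B \o ((idm B ⊠ ev D) \o (assoc B (dual D) D \o (rho ⊠ idm D))))
    \o brd D A.
Proof.
rewrite /vee_along /evr -tensm_r -!cmpA.
by rewrite -brd_nat (cmp_re (brd_slide _ _ _)) -!cmpA.
Qed.

(** The right-hand side depends on [x] only through its evaluation
    [X ⊗ D -> B] against [D]. The inverse braidings in [theta] and [alpha] add
    up to one inverse crossing of [dual B] with [B ⊗ dual D], which is natural
    in the latter and so can be performed on [X] instead. *)
Lemma ev_theta_alpha B D X (x : hom X (B ⊗ dual D)) :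
  ev (dual B ⊗ D) \o
    ((theta (dual B) D \o ((alpha B ⊠ idm (dual D)) \o x)) ⊠ idm (dual B ⊗ D))
  = (ev B \o (idm (dual B) ⊠ (runit B \o ((idm B ⊠ ev D)
      \o (assoc B (dual D) D \o (x ⊠ idm D)))))) \o swap X (dual B) D.
Proof.
have swap_runit P A :
    (idm A ⊠ runit P) \o swap P A one = brdi A P \o (idm P ⊠ runit A).
  exact: (@slide_runit (reverse C)).
transitivity (lunit one \o (((ev B \o brdi (dual B) B) ⊠ ev D)
    \o (mid B D (brdi (dual B) (dual D)) \o (x ⊠ idm (dual B ⊗ D))))).
  have e : mid (dual (dual B)) D (brdi (dual B) (dual D))
      \o ((alpha B ⊠ idm (dual D)) ⊠ (idm (dual B) ⊠ idm D))
    = ((alpha B ⊠ idm (dual B)) ⊠ (idm (dual D) ⊠ idm D))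
      \o mid B D (brdi (dual B) (dual D)).
    by apply: mid_nat; rewrite brdi_nat.
  rewrite -tensm_l cmpA curryK -tensm_l -(curryK (ev B \o _)) -/(alpha B).
  move: (mid _ _ _) (mid _ _ _) e => m m'; rewrite tensm1 => e.
  rewrite -!cmpA (cmp_re e) -!cmpA (cmp_re (esym (tensmM _ _ _ _))).
  by rewrite tensm1 cmpm1.
rewrite midE -!cmpA.
have e V (k : hom V _) :
    (idm (dual B) ⊠ assoc B (dual D) D) \o (swap (B ⊗ dual D) (dual B) D \o k)
  = swap B (dual B) (dual D ⊗ D)
    \o ((idm B ⊠ swap (dual D) (dual B) D) \o (assoc B (dual D) (dual B ⊗ D) \o k)).
  by rewrite (cmp_re (swap_tensl _ _ _ _)) -!cmpA.
rewrite -!tensm_r -!cmpA.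
rewrite -(swap_nat x (idm (dual B)) (idm D)) tensm1 e.
rewrite (cmp_re (esym (swap_nat _ _ _))) -!cmpA.
rewrite (cmp_re (swap_runit _ _)) -!cmpA.
rewrite -[(ev B \o _) ⊠ ev D]tensm_lr -!cmpA lunit_one (cmp_re (runit_nat _)) -!cmpA.
rewrite -(tensm1 B (dual B)) (cmp_re (esym (associ_nat _ _ _))) -!cmpA.
by rewrite -runit_tens -!cmpA (cmp_re (associK _ _ _)) cmp1m.
Qed.

Lemma along_evr_inj A B D (rho rho' : hom A (B ⊗ dual D))
    (alpha_mono : forall M N : C, mono (alpha M ⊠ idm N))
    (theta_mono : forall M N : C, mono (theta M N)) :
  vee_along (evr D) rho = vee_along (evr D) rho' -> rho = rho'.
Proof.
rewrite !along_evr => /(cancel_r (brdiK _ _)) e.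
apply: (alpha_mono B (dual D)); apply: (theta_mono (dual B) D); apply: curry_inj.
by rewrite !ev_theta_alpha e.
Qed.

Lemma vee_curry A B U D (w : hom (D ⊗ U) one) (rho : hom A (B ⊗ U)) :
  vee rho \o (curry w ⊠ idm A) = vee_along w rho.
Proof. by rewrite veeE -along_prel curryK. Qed.

(** Both conditions are equalities of morphisms, and [vee_along (evr P)] turns
    the first into the second; being injective, it also reflects it. *)
Lemma comeasuring_along (Om : Type) (s t : Om -> nat) (A B : omega_magma C s t)
    (P : comonoid C) (rho : hom (om_ob A) (B ⊗ dual_mon P))
    (alpha_mono : forall M N : C, mono (alpha M ⊠ idm N))
    (theta_mono : forall M N : C, mono (theta M N)) :
  is_comeasuring rho <-> is_measuring (vee_along (evr P) rho).
Proof.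
have powE n :
    vee_along (evr P) (comeas_pow rho n) = meas_pow (vee_along (evr P) rho) n.
  by apply: (@along_comeas_pow C P (dual_mon P)); apply: evr_multiplicative.
split=> h w; first by rewrite -!powE -along_prer h along_pushl.
apply: along_evr_inj => //.
by rewrite along_prer along_pushl !powE h.
Qed.

End Evaluation.

(** * Comonoid morphisms into a finite dual *)

(** Naturality of the adjunction in the comonoid, at the identity of the finite
    dual. *)
Lemma fd_adjV_eta (C : prerigid) (F : finite_dual C) (Q : monoid C)
    (D : comonoid C) (f : comon_hom D (fdual F Q)) :
  mh_fun (@fd_adjV C F Q D f) = dualm (ch_fun f) \o mh_fun (eta F Q).
Proof.
have := fd_nat F (@idm (Mon C) Q) f (eta F Q).
rewrite cf_id cmp1m cmpm1 /eta fd_adjVK (@cmp1m (Comon C)).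
by move/(congr1 (@fd_adjV C F Q D)); rewrite fd_adjK => <-.
Qed.

(** By its definition, [varkappa] pairs the finite dual with [Q] as [eta] does
    through [evr]; together with [fd_adjV_eta] this produces the adjoint of
    [f]. *)
Lemma kappa_along (C : prerigid) (F : finite_dual C) (A B : C) (Q : monoid C)
    (rho : hom A (B ⊗ Q)) (D : comonoid C) (f : comon_hom D (fdual F Q)) :
  (vee rho \o (varkappa F Q ⊠ idm A)) \o (ch_fun f ⊠ idm A)
  = vee_along (evr D) ((idm B ⊠ mh_fun (@fd_adjV C F Q D f)) \o rho).
Proof.
rewrite vee_curry -along_prel along_pushr fd_adjV_eta evr_mor ev_dualm.
congr (vee_along _ _).
by rewrite -!cmpA brd_nat (cmp_re (tensm_lr _ _)).
Qed.

Theorem theorem3p24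
  (C : prerigid) (F : finite_dual C)
  (alpha_mono : forall M N : C, mono (alpha M ⊠ idm N))
  (theta_mono : forall M N : C, mono (theta M N))
  (Om : Type) (s t : Om -> nat) (A B : omega_magma C s t)
  (U : C) (rhoU : hom (om_ob A) (B ⊗ U)) (rhoU_epi : tensor_epi rhoU)
  (AU : monoid C) (rhoC : hom (om_ob A) (B ⊗ AU))
  (rhoC_univ : is_universal_comeasuring rhoU rhoC)
  (CU : comonoid C) (psiM : hom (CU ⊗ A) B)
  (psiM_univ : is_universal_measuring (vee rhoU) psiM) :
  let kappa : hom (fdual F AU ⊗ A) B :=
    vee rhoC \o (varkappa F AU ⊠ idm (om_ob A)) in
  is_measuring kappa
  /\ exists beta : comon_hom (fdual F AU) CU,
      unique (fun b : comon_hom (fdual F AU) CU =>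
                psiM \o (ch_fun b ⊠ idm (om_ob A)) = kappa) beta
      /\ @is_iso (Comon C) (fdual F AU) CU beta.
Proof.
move=> kappa.
case: rhoC_univ => [[rhoC_comeas [tau tauE]] rhoC_init].
case: psiM_univ => [[psiM_meas [sig sigE]] psiM_term].
have below D (f : comon_hom D (fdual F AU)) :
    comeas_below rhoU ((idm (om_ob B) ⊠ mh_fun (@fd_adjV C F AU D f)) \o rhoC).
  split; first exact: comeasuring_push.
  exists (mh_fun (@fd_adjV C F AU D f) \o tau).
  by rewrite -tauE (cmp_re (tensm_r _ _ _)).
have kappa_id : kappa = kappa \o (ch_fun (comon_id (fdual F AU)) ⊠ idm (om_ob A)).
  by rewrite /= tensm1 cmpm1.
have kappa_below : meas_below (vee rhoU) kappa.
  rewrite kappa_id kappa_along.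
  have [h [tau' e]] := below _ (comon_id (fdual F AU)).
  split; first exact/comeasuring_along.
  by exists (curry (evr _ \o (idm _ ⊠ tau'))); rewrite vee_curry -along_pushr e.
split; first by case: kappa_below.
have kappa_inj D (f g : comon_hom D (fdual F AU)) :
    kappa \o (ch_fun f ⊠ idm (om_ob A)) = kappa \o (ch_fun g ⊠ idm (om_ob A))
    -> f = g.
  rewrite !kappa_along => e; move: (along_evr_inj alpha_mono theta_mono e) => {}e.
  have [phi [_ phi_uniq]] := rhoC_init _ _ (below _ g).
  rewrite -[f](@fd_adjVK C F AU D) -[g](@fd_adjVK C F AU D).
  by rewrite -(phi_uniq _ e) -(phi_uniq _ erefl).
have [beta [betaE beta_uniq]] := psiM_term _ _ kappa_below.
exists beta; split=> //.
(* The comeasuring that corresponds to [psiM]: [sig : CU -> U^*] is replaced by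
   its transpose [U -> CU^*]. *)
pose rho' := (idm (om_ob B) ⊠ curryr (ev U \o (sig ⊠ idm U))) \o rhoU.
have rho'E : vee_along (evr CU) rho' = psiM.
  by rewrite along_pushr curryrK along_prel -veeE.
have rho'_below : comeas_below rhoU (Q := dual_mon CU) rho'.
  split; last by exists (curryr (ev U \o (sig ⊠ idm U))).
  by apply/comeasuring_along => //; rewrite rho'E.
have [phi [phiE _]] := rhoC_init _ _ rho'_below.
pose gamma : comon_hom CU (fdual F AU) := @fd_adj C F AU CU phi.
have gammaE : kappa \o (ch_fun gamma ⊠ idm (om_ob A)) = psiM.
  by rewrite kappa_along fd_adjK phiE.
exists gamma; split.
  apply: kappa_inj; rewrite -kappa_id /= -tensm_l cmpA gammaE.
  exact: betaE.
(* [psiM] is terminal, so it has a unique morphism [b] to itself. *)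
have [b [_ b_uniq]] := psiM_term _ _ (conj psiM_meas (ex_intro _ sig sigE)).
transitivity b; first apply/esym.
  by apply: b_uniq; rewrite /= -tensm_l cmpA betaE.
by apply: b_uniq; rewrite /= tensm1 cmpm1.
Qed.
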